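(* Every 3-dimensional nontrivial $\omega$-Lie algebra over $\mathbb{C}$ is multiplicative.
   Context: An $\omega$-Lie algebra over $\mathbb{C}$ is a triple $(\mathfrak{g},[-,-],\omega)$ where $\mathfrak{g}$ is a finite-dimensional complex vector space, $[-,-]$ is a skew-symmetric bilinear bracket on $\mathfrak{g}$ and $\omega:\mathfrak{g}\times\mathfrak{g}\to\mathbb{C}$ is a skew-symmetric bilinear form such that $$[[x,y],z]+[[y,z],x]+[[z,x],y]=\omega(x,y)z+\omega(y,z)x+\omega(z,x)y$$ for all $x,y,z\in\mathfrak{g}$. It is called nontrivial if $(\mathfrak{g},[-,-])$ is not a Lie algebra. A complex vector space $V$ is a $\mathfrak{g}$-module if there is a bilinear map $\mathfrak{g}\times V\to V$, $(x,v)\mapsto x\cdot v$, such that $[x,y]\cdot v=x\cdot(y\cdot v)-y\cdot(x\cdot v)+\omega(x,y)v$ for all $x,y\in\mathfrak{g}$ and $v\in V$. An $\omega$-Lie algebra $\mathfrak{g}$ is called multiplicative if it has a 1-dimensional $\mathfrak{g}$-module. *)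

(* Defs.v *)
From HB Require Import structures.
From mathcomp Require Import all_boot all_order all_algebra.
From mathcomp Require Export sesquilinear reals complex.

Set Implicit Arguments.
Unset Strict Implicit.
Unset Printing Implicit Defensive.

Import GRing.Theory.
Local Open Scope ring_scope.

(* A vectType is finite-dimensional by definition. *)
Record omegaLieAlgebra (F : fieldType) := OmegaLieAlgebra {
  ola_carrier :> vectType F;
  ola_bracket : {bilinear ola_carrier -> ola_carrier -> ola_carrier};
  ola_form : {biscalar ola_carrier};
  ola_bracket_skew : forall x y, ola_bracket x y = - ola_bracket y x;
  ola_form_skew : forall x y, ola_form x y = - ola_form y x;
  ola_jacobi : forall x y z,
    ola_bracket (ola_bracket x y) z + ola_bracket (ola_bracket y z) x
      + ola_bracket (ola_bracket z x) y
    = ola_form x y *: z + ola_form y z *: x + ola_form z x *: y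
}.

Section OmegaLie.
Variables (F : fieldType) (g : omegaLieAlgebra F).

Local Notation "[[ x , y ]]" := (ola_bracket g x y)
  (at level 0, format "[[ x ,  y ]]").

(* Over a field of characteristic different from 2, skew-symmetric and
   alternating brackets coincide. *)
Definition is_lie_bracket (L : lmodType F) (br : {bilinear L -> L -> L}) : Prop :=
  (forall x y, br x y = - br y x) /\
  (forall x y z, br (br x y) z + br (br y z) x + br (br z x) y = 0).

Definition ola_nontrivial : Prop := ~ is_lie_bracket (ola_bracket g).

Definition is_module_action (V : lmodType F) (act : {bilinear g -> V -> V}) : Prop :=
  forall (x y : g) (v : V),
    act [[x, y]] v = act x (act y v) - act y (act x v) + ola_form g x y *: v.

Definition multiplicative : Prop :=
  exists (V : vectType F) (act : {bilinear g -> V -> V}),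
    \dim {:V} = 1%N /\ is_module_action act.

End OmegaLie.

(* Main.v *)
From HB Require Import structures.
From mathcomp Require Import all_boot all_order all_algebra.
From mathcomp Require Import ring.
Import GRing.Theory.
Require Import Defs.
Local Open Scope ring_scope.
Local Open Scope complex_scope.

(** A one-dimensional module over [g] is the same thing as a linear functional
    [k] with [k [x, y] = omega (x, y)]: scalars commute, so the two terms
    [x . (y . v)] and [y . (x . v)] of the module identity cancel.  Viewing the
    bracket and the form as linear maps [B] and [W] on the exterior square of
    [g], the question is whether [W] factors through [B], that is, whether
    [ker B] is contained in [ker W].

    In dimension 3 every element of the exterior square is a pure wedge
    [x /\ y], so it suffices that [[x, y] = 0] forces [omega (x, y) = 0]
    ([form_commuting]).  If [omega (x, y)] were nonzero, [x] and [y] could be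
    completed by some [z] to a basis.  Let [phi] be the [z]-coordinate.  As [x]
    and [y] commute, [[v, x]] and [[v, y]] only depend on [phi v], and applying
    [phi] to the Jacobi identity of [x], [y], [z] leaves
    [phi [y, z] * phi [z, x] - phi [z, x] * phi [y, z] = omega (x, y)],
    whose left-hand side is zero by commutativity of the field.

    The passage from pure wedges to arbitrary bivectors is
    [bivector_relation], and the factorization of [W] through [B] is
    [exists_functional].  The argument works over any field in which [2] is
    invertible. *)

(** Each family is the image of the standard basis under a linear map out of
    the row vectors, [f] for the [v i] and [h] for the [w i].  The hypothesis is
    [ker f <= ker h], so composing [h] with any linear section of [f] over its
    image is independent of the section and solves the problem. *)
Lemma exists_functional (F : fieldType) (V : vectType F) n
    (v : 'I_n -> V) (w : 'I_n -> F) :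
  (forall u : 'rV[F]_n, \sum_i u 0 i *: v i = 0 -> \sum_i u 0 i * w i = 0) ->
  exists k : 'Hom(V, F^o), forall i, k (v i) = w i.
Proof.
move=> relP.
have evalP (W : vectType F) (x : 'I_n -> W) :
    exists f : 'Hom('rV[F]_n, W), forall u, f u = \sum_i u 0 i *: x i.
  have linf : linear (fun u : 'rV[F]_n => \sum_i u 0 i *: x i).
    move=> a u t; rewrite scaler_sumr -big_split; apply: eq_bigr => i _ /=.
    by rewrite !mxE scalerDl scalerA.
  pose fL := HB.pack (fun u : 'rV[F]_n => \sum_i u 0 i *: x i)
    (GRing.isLinear.Build _ _ _ _ _ linf) : {linear 'rV[F]_n -> W}.
  by exists (linfun fL) => u; rewrite lfunE.
have [f fE] := evalP V v.
have [h hE] := evalP F^o (fun i => w i : F^o).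
have relV u : f u = 0 -> h u = 0 by rewrite fE hE => /relP.
exists (h \o f^-1)%VF => i; rewrite comp_lfunE.
have sum_delta (W : vectType F) (x : 'I_n -> W) :
    \sum_j (delta_mx 0 i : 'rV[F]_n) 0 j *: x j = x i.
  rewrite (bigD1 i) //= big1 ?addr0 => [|j /negbTE ne_ji].
    by rewrite mxE !eqxx scale1r.
  by rewrite mxE ne_ji andbF scale0r.
have fi : f (delta_mx 0 i) = v i by rewrite fE sum_delta.
have hi : h (delta_mx 0 i) = w i by rewrite hE (sum_delta F^o).
rewrite -hi -fi; apply/eqP; rewrite -subr_eq0 -linearB /=; apply/eqP/relV.
by rewrite linearB /= limg_lfunVK ?subrr // memv_img ?memvf.
Qed.

Lemma multiplicative_of_functional (F : fieldType) (g : omegaLieAlgebra F)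
    (k : 'Hom(g, F^o)) :
  (forall x y, k (ola_bracket g x y) = ola_form g x y) -> multiplicative g.
Proof.
move=> kP.
have bil : bilinear_for *:%R *:%R (fun (x : g) (v : F^o) => k x *: v).
  split=> [v a x y | x a v w]; first by rewrite linearP scalerDl -scalerA.
  by rewrite scalerDr; congr (_ + _); rewrite /= !scalerA mulrC.
pose act := HB.pack (fun (x : g) (v : F^o) => k x *: v)
  (bilinear_isBilinear.Build _ _ _ _ _ _ _ bil) : {bilinear g -> F^o -> F^o}.
exists F^o, act; split; first by rewrite dimvf.
by move=> x y v; rewrite /act /= kP !scalerA [k y * _]mulrC subrr add0r.
Qed.

Section DimensionThree.
Variables (F : fieldType) (g : omegaLieAlgebra F).
Hypothesis char2 : (2 : F) != 0.

Local Notation "⟦ x , y ⟧" := (ola_bracket g x y)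
  (at level 0, format "⟦ x ,  y ⟧").
Local Notation om := (ola_form g).

Lemma bracketxx x : ⟦x, x⟧ = 0.
Proof.
have /eqP := ola_bracket_skew x x.
by rewrite -addr_eq0 -mulr2n -scaler_nat scaler_eq0 (negPf char2) => /eqP.
Qed.

Lemma formxx x : om x x = 0.
Proof.
have /eqP := ola_form_skew x x.
by rewrite -addr_eq0 -mulr2n -mulr_natl mulf_eq0 (negPf char2) => /eqP.
Qed.

Hypothesis dim3 : \dim {: g} = 3%N.

(** Both sides of the Jacobi identity are compared along the third vector [z]
    of a basis that extends [x] and [y]. *)
Lemma form_commuting x y : ⟦x, y⟧ = 0 -> om x y = 0.
Proof.
move=> xy0; apply/eqP/negP=> /negP om_neq0.
have free_xy : free [:: x; y].
  rewrite free_cons seq1_free span_seq1; apply/andP; split.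
    by apply: contra om_neq0 => /vlineP[a ->]; rewrite linearZl_LR formxx mulr0.
  by apply: contra om_neq0 => /eqP->; rewrite linear0r.
have /subvPn[z _ zNxy] : ~~ ({:g} <= <<[:: x; y]>>)%VS.
  apply/negP=> /dimvS; rewrite dim3 => /leq_trans/(_ (dim_span _)).
  by [].
pose X := [tuple z; x; y].
have freeX : free X by rewrite free_cons zNxy.
have spanX : <<X>>%VS = {:g}%VS.
  by apply/eqP; rewrite eqEdim subvf dim3 (eqnP freeX).
have decX v :
    v = coord X ord0 v *: z + coord X 1 v *: x + coord X (inord 2) v *: y.
  rewrite {1}(@coord_span _ _ _ X v) ?spanX ?memvf //.
  rewrite !big_ord_recl big_ord0 addr0 /= addrA.
  congr (_ + coord X _ v *: _ + coord X _ v *: _); apply: val_inj => //.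
  by rewrite /= inordK.
have phi (i : 'I_3) : coord X ord0 X`_i = (i == ord0)%:R by exact: coord_free.
have phiz := phi ord0; have phix := phi 1; have phiy := phi (inord 2).
rewrite /= in phiz phix; rewrite inordK //= -val_eqE /= inordK //= in phiy.
have brx v : ⟦v, x⟧ = coord X ord0 v *: ⟦z, x⟧.
  rewrite {1}(decX v) !linearDl /= !linearZl_LR /= bracketxx.
  by rewrite (ola_bracket_skew y x) xy0 oppr0 !scaler0 !addr0.
have bry v : ⟦v, y⟧ = coord X ord0 v *: ⟦z, y⟧.
  rewrite {1}(decX v) !linearDl /= !linearZl_LR /= bracketxx.
  by rewrite xy0 !scaler0 !addr0.
have /(congr1 (coord X ord0)) := ola_jacobi x y z.
rewrite xy0 linear0l add0r brx bry (ola_bracket_skew z y).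
rewrite !linearD !linearZ /= linearN /= phix phiy phiz.
rewrite !mulr0 !addr0 mulr1 mulrN mulrC subrr => om0.
by rewrite -om0 eqxx in om_neq0.
Qed.

(** The bivector [r (b /\ c) + s (c /\ a) + t (a /\ b)], multiplied by its
    nonzero coordinate [t], is the pure wedge
    [(t a - r c) /\ (t b - s c)]. *)
Lemma bivector_relation_pivot a b c (r s t : F) : t != 0 ->
  r *: ⟦b, c⟧ + s *: ⟦c, a⟧ + t *: ⟦a, b⟧ = 0 ->
  r * om b c + s * om c a + t * om a b = 0.
Proof.
move=> t0 rel0.
have : om (t *: a - r *: c) (t *: b - s *: c) = 0.
  apply: form_commuting; rewrite linearBl !linearBr /= !linearZl_LR !linearZr_LR /=.
  rewrite bracketxx !scaler0 subr0 (ola_bracket_skew a c) (ola_bracket_skew c b).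
  transitivity (t *: (r *: ⟦b, c⟧ + s *: ⟦c, a⟧ + t *: ⟦a, b⟧)).
    rewrite !scalerN !opprK !scalerDr !scalerA [r * t]mulrC.
    by rewrite [RHS]addrC [(t * r) *: _ + _]addrC addrA.
  by rewrite rel0 scaler0.
rewrite linearBl !linearBr /= !linearZl_LR !linearZr_LR /= formxx.
rewrite (ola_form_skew a c) (ola_form_skew c b) => om0.
by apply: (mulfI t0); rewrite mulr0 -[RHS]om0; ring.
Qed.

Lemma bivector_relation a b c (r s t : F) :
  r *: ⟦b, c⟧ + s *: ⟦c, a⟧ + t *: ⟦a, b⟧ = 0 ->
  r * om b c + s * om c a + t * om a b = 0.
Proof.
(* Rotating [a], [b], [c] brings any nonzero coordinate to the last place. *)
have rotD (V : zmodType) (x y z : V) : x + y + z = z + x + y.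
  by rewrite addrC addrA.
have [-> | t0] := eqVneq t 0; last exact: bivector_relation_pivot.
have [-> | s0] := eqVneq s 0.
  have [-> _ | r0] := eqVneq r 0; first by rewrite !mul0r !addr0.
  by do 2!rewrite (rotD g) (rotD F); apply: bivector_relation_pivot.
by rewrite (rotD g) (rotD F); apply: bivector_relation_pivot.
Qed.

(** On a basis [a], [b], [c], the equation [k [x, y] = omega (x, y)] is three
    conditions, on the cyclic pairs, because both sides are alternating. *)
Lemma multiplicative_dim3 : multiplicative g.
Proof.
have [a [b [c decg]]] : exists a b c : g, forall v,
    exists p q r, v = p *: a + q *: b + r *: c.
  have := size_tuple (vbasis {: g}); have := vbasisP {: g}.
  move: (tval _) => e basis_e; rewrite dim3 => size_e.
  case: e size_e basis_e => [|a [|b [|c []]]] //= _.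
  move=> /span_basis spanE; exists a, b, c => v.
  have: v \in <<[:: a; b; c]>>%VS by rewrite spanE memvf.
  rewrite !span_cons span_nil addv0 => /memv_addP[_ /vlineP[p ->]].
  case=> _ /memv_addP[_ /vlineP[q ->] [_ /vlineP[r ->] ->]] ->.
  by exists p, q, r; rewrite addrA.
pose v := tnth [tuple ⟦b, c⟧; ⟦c, a⟧; ⟦a, b⟧].
pose w := tnth [tuple om b c; om c a; om a b].
have [u | k kP] := @exists_functional F g 3 v w.
  rewrite !big_ord_recr !big_ord0 /= !add0r; exact: bivector_relation.
have kbc := kP 0; have kca := kP 1; have kab := kP (inord 2).
rewrite /v /w !(tnth_nth 0) /= in kbc kca kab; rewrite inordK //= in kab.
apply: (@multiplicative_of_functional _ _ k) => x y.
have kZ t z : k (t *: z) = t * k z by rewrite linearZ.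
have [p [q [r ->]]] := decg x; have [p' [q' [r' ->]]] := decg y.
rewrite !linearDl /= !linearDr /= !linearZl_LR /= !linearZr_LR /=.
rewrite !bracketxx !formxx (ola_bracket_skew b a) (ola_bracket_skew a c).
rewrite (ola_bracket_skew c b) (ola_form_skew b a) (ola_form_skew a c).
rewrite (ola_form_skew c b) !linearD /= !kZ linear0 !linearN /= kab kbc kca.
ring.
Qed.
End DimensionThree.

Theorem theorem6p5 (R : realType) (g : omegaLieAlgebra R[i]) :
  \dim {: g} = 3%N -> ola_nontrivial g -> multiplicative g.
Proof.
move=> dim3 _; apply: multiplicative_dim3 => //.
by rewrite Num.Theory.pnatr_eq0.
Qed.
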